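(* Every digraph of finite type is acyclic. That is, if $Q$ is a digraph such that the Hecke-Kiselman monoid $H_Q$ is finite, then $Q$ contains no cycles.
   Context: A digraph $Q$ is a graph with at most one connection (side) between each pair of distinct vertices and no loops; each side is either an oriented arrow $i\to j$ or a non-oriented edge. The Hecke-Kiselman monoid $H_Q$ is the monoid generated by elements $a_i$, one for each vertex $i$ of $Q$, subject to the relations: $a_i^2=a_i$ for all $i$; $a_ia_j=a_ja_i$ if $i,j$ are not connected; $a_ia_ja_i=a_ja_ia_j$ if $i,j$ are connected by an edge; $a_ia_j=a_ia_ja_i=a_ja_ia_j$ if there is an arrow from $i$ to $j$. The digraph $Q$ is of finite type if $H_Q$ is finite. A cycle in $Q$ is a sequence $(v_i)_{i\in\mathbb{Z}/n\mathbb{Z}}$, $n\ge 3$, of pairwise distinct vertices such that for each $i\in\mathbb{Z}/n\mathbb{Z}$ there is in $Q$ either an edge between $v_i$ and $v_{i+1}$ or an arrow from $v_i$ to $v_{i+1}$. $Q$ is acyclic if it contains no cycles. *)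

(* Defs.v *)
From HB Require Import structures.
From mathcomp Require Import all_boot all_algebra.
From mathcomp Require Import boolp classical_sets cardinality.

Set Implicit Arguments.
Unset Strict Implicit.
Unset Printing Implicit Defensive.

Local Open Scope quotient_scope.

(* The monoid presented by generators X and relations r : the quotient of the
   free monoid seq X by the smallest congruence containing r. *)
Section PresentedMonoid.
Variables (X : Type) (r : seq X -> seq X -> Prop).

Inductive congruence_closure : seq X -> seq X -> Prop :=
| cc_rel u v : r u v -> congruence_closure u v
| cc_refl u : congruence_closure u u
| cc_sym u v : congruence_closure u v -> congruence_closure v u
| cc_trans u v w :
    congruence_closure u v -> congruence_closure v w -> congruence_closure u w
| cc_cat u u' v v' :
    congruence_closure u u' -> congruence_closure v v' ->
    congruence_closure (u ++ v) (u' ++ v').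

(* {classic _} supplies the choiceType structure required by {eq_quot _}. *)
Definition pres_rel : rel {classic (seq X)} :=
  fun u v => `[< congruence_closure u v >].

Lemma pres_rel_refl : reflexive pres_rel.
Proof. by move=> u; apply/asboolP; exact: cc_refl. Qed.

Lemma pres_rel_sym : symmetric pres_rel.
Proof. by move=> u v; apply/asboolP/asboolP; exact: cc_sym. Qed.

Lemma pres_rel_trans : transitive pres_rel.
Proof.
by move=> v u w /asboolP uv /asboolP vw; apply/asboolP; exact: cc_trans uv vw.
Qed.

Canonical pres_equiv :=
  EquivRel pres_rel pres_rel_refl pres_rel_sym pres_rel_trans.

Definition presented_monoid : Type := {eq_quot pres_equiv}.

HB.instance Definition _ := Choice.on presented_monoid.
HB.instance Definition _ := EqQuotient.on presented_monoid.

Definition word_class (u : seq X) : presented_monoid :=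
  \pi_presented_monoid (u : {classic (seq X)}).

Definition pres_repr (x : presented_monoid) : seq X := repr x.

Definition pres_mul (x y : presented_monoid) : presented_monoid :=
  word_class (pres_repr x ++ pres_repr y).

Lemma word_classP (u v : seq X) :
  word_class u = word_class v <-> congruence_closure u v.
Proof.
split=> [/eqquotP/asboolP //|uv].
by apply/eqquotP/asboolP.
Qed.

Lemma pres_reprK (x : presented_monoid) : word_class (pres_repr x) = x.
Proof. exact: reprK. Qed.

Lemma word_class_surj (x : presented_monoid) : exists u, x = word_class u.
Proof. by exists (pres_repr x); rewrite pres_reprK. Qed.

Lemma word_class_cat (u v : seq X) :
  word_class (u ++ v) = pres_mul (word_class u) (word_class v).
Proof. by apply/word_classP/cc_cat; apply/word_classP; rewrite pres_reprK. Qed.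

Lemma pres_mulA : associative pres_mul.
Proof.
move=> x y z.
have [u ->] := word_class_surj x; have [v ->] := word_class_surj y.
by have [w ->] := word_class_surj z; rewrite -!word_class_cat catA.
Qed.

Lemma pres_mul1 : left_id (word_class [::]) pres_mul.
Proof. by move=> x; have [u ->] := word_class_surj x; rewrite -word_class_cat. Qed.

Lemma pres_mulr1 : right_id (word_class [::]) pres_mul.
Proof.
by move=> x; have [u ->] := word_class_surj x; rewrite -word_class_cat cats0.
Qed.

HB.instance Definition _ :=
  isMonoid.Build presented_monoid pres_mulA pres_mul1 pres_mulr1.

End PresentedMonoid.

(* The vertex type is arbitrary: digraphs are not assumed finite. *)
Record digraph := Digraph {
  vertex :> Type;
  edge : rel vertex;
  arrow : rel vertex;
  edge_irreflexive : irreflexive edge;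
  arrow_irreflexive : irreflexive arrow;
  edge_symmetric : symmetric edge;
  arrow_asymmetric : forall i j, arrow i j -> ~~ arrow j i;
  edge_not_arrow : forall i j, edge i j -> ~~ arrow i j
}.

Definition connected (Q : digraph) (i j : Q) : bool :=
  [|| edge i j, arrow i j | arrow j i].

Inductive hk_relation (Q : digraph) : seq Q -> seq Q -> Prop :=
| hk_idem i : hk_relation [:: i; i] [:: i]
| hk_comm i j : ~~ connected i j -> hk_relation [:: i; j] [:: j; i]
| hk_braid i j : edge i j -> hk_relation [:: i; j; i] [:: j; i; j]
| hk_arrowl i j : arrow i j -> hk_relation [:: i; j] [:: i; j; i]
| hk_arrowr i j : arrow i j -> hk_relation [:: i; j; i] [:: j; i; j].

Definition hecke_kiselman (Q : digraph) : monoidType :=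
  presented_monoid (@hk_relation Q).

Definition finite_type (Q : digraph) : Prop :=
  finite_set [set: hecke_kiselman Q].

(* 'Z_n is the ring Z/nZ because n >= 3, so i + 1 wraps around. *)
Definition is_cycle (Q : digraph) (n : nat) (v : 'Z_n -> Q) : Prop :=
  [/\ 3 <= n, injective v &
      forall i : 'Z_n, edge (v i) (v (i + 1)%R) || arrow (v i) (v (i + 1)%R)].

Definition acyclic (Q : digraph) : Prop :=
  forall (n : nat) (v : 'Z_n -> Q), ~ is_cycle v.

(* Main.v *)
(** Let a cycle v of length n be given. Every vertex q acts on functions
    x : Z/n -> nat by replacing x j with x (j + 1) + 1 when q = v j; vertices
    outside the cycle act trivially. The defining relations of H_Q hold for these
    operators: chords of the cycle become commutations, edges of the cycle become
    arrows v j -> v (j + 1), and both replacements only strengthen the relations.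
    The word v_0 v_1 ... v_(k-1) sends the zero function to one whose value at 0
    is k, so H_Q is infinite. *)
From mathcomp Require Import all_boot all_algebra.
From mathcomp Require Import boolp classical_sets cardinality.
Require Import Defs.

Set Implicit Arguments.
Unset Strict Implicit.
Unset Printing Implicit Defensive.

Import GRing.Theory.

(** A cycle length of at least 3 makes [1 + 1] nonzero in Z/n. *)
Lemma Zp_add2_neq (n : nat) (j : 'Z_n) : 2 < n -> (j + 1 + 1)%R <> j.
Proof.
case: n j => [|[|[|n]]] // j _ /eqP.
by rewrite -addrA -[X in _ == X]addr0 (inj_eq (addrI j)).
Qed.

Section CycleAction.
Variables (Q : digraph) (n : nat) (v : 'Z_n -> Q).

(** Testing [v j = q] at every [j] avoids choosing an index for [q]; the test is classical because
    vertices have no decidable equality. *)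
Definition step (q : Q) (x : 'Z_n -> nat) (j : 'Z_n) : nat :=
  if `[< v j = q >] then (x (j + 1)%R).+1 else x j.

Definition act (w : seq Q) (x : 'Z_n -> nat) : 'Z_n -> nat := foldr step x w.

Lemma act_cat (u w : seq Q) (x : 'Z_n -> nat) : act (u ++ w) x = act u (act w x).
Proof. exact: foldr_cat. Qed.

Lemma step_on (x : 'Z_n -> nat) (j : 'Z_n) : step (v j) x j = (x (j + 1)%R).+1.
Proof. by rewrite /step; case: asboolP. Qed.

Lemma step_off (q : Q) (x : 'Z_n -> nat) (j : 'Z_n) : v j <> q -> step q x j = x j.
Proof. by rewrite /step; case: asboolP. Qed.

Fixpoint cycle_word (k : nat) (j : 'Z_n) : seq Q :=
  if k is k'.+1 then v j :: cycle_word k' (j + 1)%R else [::].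

(** The rightmost letter acts first, so [v j] adds one to the value that the rest of the word has
    already built at [j + 1]. *)
Lemma act_cycle_word (k : nat) (j : 'Z_n) : act (cycle_word k j) (fun=> 0) j = k.
Proof. by elim: k j => //= k IH j; rewrite step_on IH. Qed.

Hypothesis cyc : is_cycle v.

Let side (j : 'Z_n) : edge (v j) (v (j + 1)%R) || arrow (v j) (v (j + 1)%R).
Proof. by case: cyc. Qed.

Lemma cycle_next_neq (j : 'Z_n) : v (j + 1)%R <> v j.
Proof.
by move=> e; have := side j; rewrite e edge_irreflexive arrow_irreflexive.
Qed.

Lemma cycle_next2_neq (j : 'Z_n) : v (j + 1 + 1)%R <> v j.
Proof. by case: cyc => n_gt2 v_inj _ /v_inj; exact: Zp_add2_neq. Qed.

Lemma step_idem (q : Q) (x : 'Z_n -> nat) : step q (step q x) = step q x.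
Proof.
apply/funext => j; have [<-|jq] := pselect (v j = q); last by rewrite !step_off.
by rewrite !step_on step_off //; exact: cycle_next_neq.
Qed.

Lemma step_comm (p q : Q) (x : 'Z_n -> nat) :
  ~~ connected p q -> step p (step q x) = step q (step p x).
Proof.
rewrite /connected !negb_or => /and3P[Epq Apq Aqp].
(* Unconnected vertices are never consecutive on the cycle, so neither operator reads a position
   that the other writes. *)
have off a b j : ~~ edge a b -> ~~ arrow a b -> v j = a -> v (j + 1)%R <> b.
  by move=> Eab Aab ja jb; have := side j; rewrite ja jb (negPf Eab) (negPf Aab).
have [->//|pq] := pselect (p = q).
apply/funext => j; have [jp|jp] := pselect (v j = p).
  have jq : v j <> q by rewrite jp.
  rewrite (step_off (step p x) jq) -jp !step_on step_off //; exact: off jp.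
rewrite (step_off _ jp); have [jq|jq] := pselect (v j = q).
  rewrite -jq !step_on step_off //; apply: off jq => //.
  by rewrite edge_symmetric.
by rewrite !step_off.
Qed.

(** The value at [j] depends on [x] only at [j + 1] or [j + 2], and the innermost [step p] changes
    neither, as both vertices differ from [p]. *)
Lemma step_braid_at (p q : Q) (x : 'Z_n -> nat) (j : 'Z_n) : v j = p -> p <> q ->
  step p (step q (step p x)) j = step q (step p (step q x)) j.
Proof.
move=> jp pq; have jq : v j <> q by rewrite jp.
rewrite (step_off (step p (step q x)) jq) -jp !step_on; congr _.+1.
have [<-|jq1] := pselect (v (j + 1)%R = q).
  by rewrite !step_on step_off //; exact: cycle_next2_neq.
by rewrite !step_off //; exact: cycle_next_neq.
Qed.

Lemma step_braid (p q : Q) (x : 'Z_n -> nat) :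
  step p (step q (step p x)) = step q (step p (step q x)).
Proof.
have [->//|pq] := pselect (p = q).
apply/funext => j; have [jp|jp] := pselect (v j = p).
  exact: step_braid_at.
have [jq|jq] := pselect (v j = q); last by rewrite !step_off.
by apply/esym/step_braid_at => // /esym.
Qed.

Lemma step_arrow (p q : Q) (x : 'Z_n -> nat) : arrow p q ->
  step p (step q x) = step p (step q (step p x)).
Proof.
move=> Apq; apply/funext => j; have [jp|jp] := pselect (v j = p).
  rewrite -jp !step_on; have [<-|jq1] := pselect (v (j + 1)%R = q).
    by rewrite !step_on step_off //; exact: cycle_next2_neq.
  by rewrite !step_off //; exact: cycle_next_neq.
rewrite !(step_off _ jp); have [jq|jq] := pselect (v j = q); last first.
  by rewrite !step_off.
(* If [p] came right after [q] on the cycle, an edge or an arrow would lead from [q] to [p], against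
   [arrow p q]. *)
rewrite -jq !step_on step_off // => jp1; have := side j.
rewrite jq jp1 (negPf (arrow_asymmetric Apq)) orbF edge_symmetric.
by move=> /edge_not_arrow; rewrite Apq.
Qed.

Lemma act_congr (u w : seq Q) :
  congruence_closure (@hk_relation Q) u w -> act u = act w.
Proof.
elim=> [{}u {}w r|//|//|u1 u2 u3 _ -> _ ->//|u1 u2 w1 w2 _ IHu _ IHw].
  apply/funext => x; case: r => [i|i j|i j _|i j|i j _] /=.
  - exact: step_idem.
  - exact: step_comm.
  - exact: step_braid.
  - exact: step_arrow.
  - exact: step_braid.
by apply/funext => x; rewrite !act_cat IHu IHw.
Qed.

Lemma cycle_infinite_type : ~ finite_type Q.
Proof.
(* [height] is computed on a chosen representative; by [act_congr] any other word of the class gives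
   the same value. Its image is all of [nat]. *)
pose height (h : hecke_kiselman Q) := act (pres_repr h) (fun=> 0) 0%R.
move=> /(finite_image height); apply: (sub_infinite_set _ infinite_nat) => k _.
exists (word_class (@hk_relation Q) (cycle_word k 0%R)) => //.
rewrite -[RHS](act_cycle_word k 0%R) /height; congr (_ _ _).
by apply: act_congr; apply/word_classP; rewrite pres_reprK.
Qed.

End CycleAction.

Theorem theorem2p7 (Q : digraph) : finite_type Q -> acyclic Q.
Proof. by move=> finQ n v /cycle_infinite_type. Qed.
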